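(* For every strongly regular graph $G=\mathrm{srg}(n,k,\lambda,\mu)$ with $\mu\ge1$, we have $\mathrm{QEC}(G)\ge0$, except when $G$ is the cycle $C_5=\mathrm{srg}(5,2,0,1)$, for which \[ \mathrm{QEC}(C_5)=-\frac{3-\sqrt5}{2}<0. \]
   Context: A graph $G=(V,E)$ is finite and simple. It is strongly regular with parameters $\mathrm{srg}(n,k,\lambda,\mu)$ if $|V|=n$, every vertex has exactly $k$ neighbours, every two adjacent vertices have exactly $\lambda$ common neighbours, and every two distinct non-adjacent vertices have exactly $\mu$ common neighbours. The hypothesis $\mu\ge1$ means in particular that there exist distinct non-adjacent vertices (so $G$ is not complete) and that $G$ is connected. For a connected graph $G=(V,E)$ with $|V|\ge2$, let $D=[d(x,y)]_{x,y\in V}$ be its distance matrix ($d$ the graph distance), and define the quadratic embedding constant \[ \mathrm{QEC}(G)=\max\{\langle f,Df\rangle : f\in\mathbb{R}^V,\ \langle f,f\rangle=1,\ \langle \mathbf{1},f\rangle=0\}, \] where $\mathbf 1$ is the all-ones vector and $\langle\cdot,\cdot\rangle$ the standard inner product. *)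

(* Defs.v *)
From HB Require Import structures.
From mathcomp Require Import all_boot all_order all_algebra.
From mathcomp Require Import classical_sets reals.
Set Implicit Arguments. Unset Strict Implicit. Unset Printing Implicit Defensive.
Import Order.TTheory GRing.Theory Num.Theory.
Local Open Scope ring_scope.

(* A finite simple graph: vertex type T : finType, adjacency e : rel T,
   assumed symmetric and irreflexive. *)

Section Graph.
Variables (T : finType) (e : rel T).

Fixpoint reach (m : nat) (x : T) : {set T} :=
  match m with
  | 0 => [set x]
  | m'.+1 => reach m' x :|: [set w | [exists z in reach m' x, e z w]]
  end.

(* graph distance: least m with y reachable within m steps
   (for a connected graph this is < #|T|, so the search range suffices) *)
Definition gdist (x y : T) : nat :=
  find (fun m => y \in reach m x) (iota 0 #|T|).


Definition srg (n k l m : nat) : Prop :=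
  [/\ #|T| = n,
      (forall x, #|[set y | e x y]| = k),
      (forall x y, e x y -> #|[set z | e x z && e y z]| = l) &
      (forall x y, x != y -> ~~ e x y -> #|[set z | e x z && e y z]| = m)].

Definition c5adj (i j : 'I_5) : bool :=
  ((i.+1 %% 5)%N == j) || ((j.+1 %% 5)%N == i).

Definition isC5 : Prop :=
  exists f : T -> 'I_5, bijective f /\ forall x y, e x y = c5adj (f x) (f y).

Definition distQ (R : numDomainType) (f : T -> R) : R :=
  \sum_(x : T) \sum_(y : T) f x * (gdist x y)%:R * f y.

(* QEC(G) = max { <f,Df> : <f,f> = 1, <1,f> = 0 }  (the max is attained;
   written as the supremum of this set) *)
Definition QEC (R : realType) : R :=
  sup [set distQ f | f in [set f : T -> R |
         \sum_(x : T) f x ^+ 2 = 1 /\ \sum_(x : T) f x = 0]]%classic.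

End Graph.

(* Main.v *)
Require Import Defs.
From mathcomp Require Import all_boot all_order all_algebra.
From mathcomp Require Import zify ring lra.
Import Order.TTheory GRing.Theory Num.Theory.
Local Open Scope ring_scope.

(** The graph has diameter 2, so its distance matrix is 2 J - 2 I - A, and on
    functions of sum 0 the distance form is - 2 <f, f> - <f, A f>. There A has
    two eigenvalues, the roots of t^2 - (l - m) t - (k - m), and the smaller one
    is at most -2 as soon as 2 l + 4 <= k + m; this gives QEC >= 0.
    Suppose instead that k + m <= 2 l + 3. Counting in the neighbourhood of a
    vertex x, around two non-adjacent neighbours of x, shows that equality
    holds, that there is no claw, and that the common neighbours of two
    non-adjacent vertices form a clique. If m >= 3, three common neighbours of a
    non-adjacent pair yield a claw; if m = 2, the graph would be 5-regular on 11
    vertices, which is impossible by parity; if m = 1 and l > 0, a triangle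
    together with a private neighbour of each of its vertices yields a claw.
    Only (k, l, m) = (2, 0, 1) remains, which is the pentagon. *)

(** * Combinatorics of strongly regular graphs *)

Section StronglyRegular.
Variables (T : finType) (e : rel T) (n k l m : nat).
Hypotheses (esym : symmetric e) (eirr : irreflexive e).
Hypothesis Hsrg : srg e n k l m.

Local Notation nbr x := [set y | e x y].
Local Notation cnbr x y := [set z | e x z && e y z].

Let cardn : #|T| = n. Proof. by case: Hsrg. Qed.
Let degk x : #|nbr x| = k. Proof. by case: Hsrg. Qed.
Let cnbr_adj x y : e x y -> #|cnbr x y| = l. Proof. by case: Hsrg => _ _ + _; apply. Qed.
Let cnbr_nadj x y : x != y -> ~~ e x y -> #|cnbr x y| = m.
Proof. by case: Hsrg => _ _ _; apply. Qed.

Lemma adj_neq x y : e x y -> x != y.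
Proof. by apply: contraTneq => ->; rewrite eirr. Qed.

Lemma distinguish_neq {x y} z : e x z -> ~~ e y z -> x != y.
Proof. by move=> xz; apply: contraNneq => <-. Qed.

(** * Distances in diameter two *)

Section Diameter2.
Hypothesis m_gt0 : (0 < m)%N.

Lemma common_neighbour x y : x != y -> ~~ e x y -> exists2 z, e x z & e y z.
Proof.
move=> xy nxy; have := cnbr_nadj _ _ xy nxy => cE.
have /card_gt0P[z] : (0 < #|cnbr x y|)%N by rewrite cE.
by rewrite inE => /andP[]; exists z.
Qed.

Lemma srg_gdist : (exists x y : T, x != y /\ ~~ e x y) ->
  forall x y, gdist e x y = if x == y then 0%N else if e x y then 1%N else 2%N.
Proof.
move=> [a [b [ab nab]]] x y.
have [c ac bc] := common_neighbour _ _ ab nab.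
(* The search in [gdist] runs over [iota 0 #|T|]; three vertices put the steps 0, 1 and 2 within its
   range. *)
have T3 : (2 < #|T|)%N.
  have us : uniq [:: a; b; c] by rewrite /= !inE negb_or ab !adj_neq.
  by rewrite -[3%N]/(size [:: a; b; c]) -(card_uniqP us) max_card.
rewrite /gdist; case: #|T| T3 => [|[|[|N]]] // _ /=.
have r1 w : (w \in [set x] :|: [set w | [exists z in [set x], e z w]]) = (w == x) || e x w.
  rewrite !inE; congr orb; apply/existsP/idP => [[z]|xw].
    by rewrite inE => /andP[/eqP->].
  by exists x; rewrite inE eqxx.
rewrite [y \in [set x]]inE eq_sym; case: eqVneq => //= xy; rewrite r1 eq_sym (negPf xy) /=.
case: ifP => //= /negbT nxy.
rewrite inE r1 eq_sym (negPf xy) (negPf nxy) /= inE.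
have -> //: [exists z in [set x] :|: [set w | [exists z in [set x], e z w]], e z y].
have [z xz yz] := common_neighbour _ _ xy nxy.
by apply/existsP; exists z; rewrite r1 xz orbT esym.
Qed.

End Diameter2.

Lemma unique_common_neighbour x y u v : m = 1%N -> x != y -> ~~ e x y ->
  e x u -> e y u -> e x v -> e y v -> u = v.
Proof.
move=> m1 xy nxy xu yu xv yv.
have /eqP/cards1P[w cE] : #|cnbr x y| = 1%N by rewrite cnbr_nadj.
have : u \in cnbr x y by rewrite inE xu yu.
have : v \in cnbr x y by rewrite inE xv yv.
by rewrite cE !inE => /eqP-> /eqP->.
Qed.

(** * Counting walks and edges *)

(** This is A^2 = k I + l A + m (J - I - A) applied to [g]: walks of length 2 from [x] to [z]
    correspond to common neighbours. *)
Lemma sum_walks2 (R : nzRingType) (g : T -> R) x :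
  \sum_(y | e x y) \sum_(z | e y z) g z =
  k%:R * g x + l%:R * (\sum_(z | e x z) g z) + m%:R * (\sum_(z | (z != x) && ~~ e x z) g z).
Proof.
rewrite (exchange_big_dep predT) //=.
rewrite (eq_bigr (fun z => #|cnbr x z|%:R * g z)); last first.
  move=> z _; rewrite sumr_const mulr_natl; congr (_ *+ _).
  by apply: eq_card => y; rewrite inE [e z y]esym.
rewrite (bigD1 x) //= (bigID (e x)) /= addrA !mulr_sumr; congr (_ + _ + _).
- by congr (_%:R * _); rewrite -(degk x); apply: eq_card => y; rewrite !inE andbb.
- rewrite (eq_bigl (e x)); first by apply: eq_bigr => z xz; rewrite cnbr_adj.
  by move=> z; rewrite andb_idl // => /adj_neq; rewrite eq_sym.
- by apply: eq_bigr => z /andP[zx xz]; rewrite cnbr_nadj // eq_sym.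
Qed.

Lemma sum_adj_split (R : nzRingType) (g : T -> R) x :
  \sum_z g z = g x + \sum_(z | e x z) g z + \sum_(z | (z != x) && ~~ e x z) g z.
Proof.
rewrite (bigD1 x) //= (bigID (e x)) /= addrA; congr (_ + _ + _).
by apply: eq_bigl => z; rewrite andb_idl // => /adj_neq; rewrite eq_sym.
Qed.

Lemma sum_nbr1 (R : nzRingType) x : \sum_(z | e x z) 1 = k%:R :> R.
Proof. by rewrite sumr_const -(degk x); congr _%:R; apply: eq_card => y; rewrite inE. Qed.

(** The classical relation k (k - l - 1) = m (n - k - 1), free of subtractions; it comes from
    [sum_walks2] on the constant 1. *)
Lemma srg_count (x : T) : (k * k + m + k * m = k + l * k + m * n)%N.
Proof.
have := sum_walks2 int (fun _ => 1) x; have := sum_adj_split int (fun _ => 1) x.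
under [in X in _ -> X]eq_bigr => y _ do rewrite sum_nbr1 -[k%:R]mulr1.
rewrite -mulr_sumr !sum_nbr1 sumr_const cardn.
set N2 := \sum_(z | _) _ => H1 H2.
have {H1} : N2 = n%:R - 1 - k%:R by rewrite H1; ring.
move: H2; rewrite !natz => ? ?; nia.
Qed.

Lemma handshake : ~~ odd (n * k).
Proof.
have -> : (n * k = \sum_(x : T) \sum_(y : T) e x y)%N.
  rewrite -cardn -sum_nat_const; apply: eq_bigr => x _.
  by rewrite -(degk x) -sum1_card big_mkcond /=; apply: eq_bigr => y _; rewrite inE; case: (e x y).
(* The rank orients every edge, so that the degree sum counts each oriented edge twice. *)
pose r (x : T) := enum_rank x.
have -> : (\sum_(x : T) \sum_(y : T) e x y =
    (\sum_(x : T) \sum_(y : T) (e x y && (r x < r y)%N)).*2)%N.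
  rewrite -addnn [X in (_ = _ + X)%N]exchange_big -big_split; apply: eq_bigr => x _.
  rewrite -big_split; apply: eq_bigr => y _ /=; rewrite [e y x]esym.
  case xy: (e x y) => //=; case: (ltngtP (r x) (r y)) => //= /ord_inj/enum_rank_inj E.
  by rewrite E eirr in xy.
by rewrite odd_double.
Qed.

(* The numerical form of "the least eigenvalue exceeds -2". *)
Section LargeLambda.
Hypothesis small_k : (k + m <= l.*2 + 3)%N.

(* Among the k - 2 remaining neighbours of x, each of y and y' sees l and both
   see at most m - 1; so 2 l <= (k - 2) + (m - 1), and equality must hold. *)
Lemma nadj_neighbours x y y' : e x y -> e x y' -> y != y' -> ~~ e y y' ->
  [/\ (k + m = l.*2 + 3)%N,
      cnbr x y :|: cnbr x y' = nbr x :\: [set y; y'] &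
      cnbr x y :&: cnbr x y' = cnbr y y' :\ x].
Proof.
move=> xy xy' yy' nyy'.
have sU : cnbr x y :|: cnbr x y' \subset nbr x :\: [set y; y'].
  apply/subsetP => w; rewrite !inE => /orP[] /andP[xw yw]; rewrite xw andbT negb_or.
    by rewrite eq_sym adj_neq //; apply: (distinguish_neq y) => //; rewrite 1?esym // esym.
  by rewrite andbC eq_sym adj_neq //; apply: (distinguish_neq y') => //; rewrite 1?esym // esym.
have sI : cnbr x y :&: cnbr x y' \subset cnbr y y' :\ x.
  apply/subsetP => w; rewrite !inE => /andP[/andP[xw yw] /andP[_ y'w]].
  by rewrite yw y'w andbT eq_sym adj_neq.
have cU : (#|nbr x :\: [set y; y']| + 2 = k)%N.
  rewrite -(degk x) -(cardsID [set y; y'] (nbr x)) addnC; congr addn.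
  rewrite (setIidPr _) ?cards2 ?yy' //.
  by apply/subsetP => w; rewrite !inE => /orP[] /eqP->.
have cI : (#|cnbr y y' :\ x| + 1 = m)%N.
  rewrite -(cnbr_nadj y y') // (cardsD1 x (cnbr y y')) !inE ![e _ x]esym xy xy' /=; lia.
have := cardsUI (cnbr x y) (cnbr x y'); rewrite !cnbr_adj // => cUI.
have := subset_leq_card sU; have := subset_leq_card sI => leI leU.
split; first lia.
- by apply/eqP; rewrite eqEcard sU; lia.
- by apply/eqP; rewrite eqEcard sI; lia.
Qed.

(** In the equality case, the neighbours of [u] and those of [v] cover the rest of the neighbourhood
    of [x]. *)
Lemma no_claw x u v w : e x u -> e x v -> e x w ->
  u != v -> ~~ e u v -> w != u -> w != v -> e u w || e v w.
Proof.
move=> xu xv xw uv nuv wu wv; have [_ + _] := nadj_neighbours x u v xu xv uv nuv.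
by move/setP/(_ w); rewrite !inE xw (negPf wu) (negPf wv) /= => ->.
Qed.

(** The equality case, read at [p]: common neighbours of [u] and [v] other than [p] are neighbours
    of [p]. *)
Lemma no_induced_C4 u v p q : u != v -> ~~ e u v ->
  e u p -> e v p -> e u q -> e v q -> p != q -> e p q.
Proof.
move=> uv nuv up vp uq vq pq.
rewrite esym in up; rewrite esym in vp.
have [_ _] := nadj_neighbours p u v up vp uv nuv.
by move/setP/(_ q); rewrite !inE eq_sym pq uq vq !andbT andbb.
Qed.

Lemma srg_parameters : (exists x y : T, x != y /\ ~~ e x y) -> (0 < m)%N ->
  (k + m = l.*2 + 3)%N.
Proof.
move=> [a [b [ab nab]]] m0; have [c ac bc] := common_neighbour m0 _ _ ab nab.
rewrite esym in ac; rewrite esym in bc.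
by have [] := nadj_neighbours c a b ac bc ab nab.
Qed.

(** * Non-neighbours of a vertex inside a neighbourhood *)

Local Notation far x u := [set w | [&& e x w, w != u & ~~ e u w]].

(** The size does not depend on [x] and [u], so an inclusion between two such sets is an
    equality. *)
Lemma card_far x u : e x u -> (#|far x u| + l + 1 = k)%N.
Proof.
move=> xu; rewrite -(degk x) (cardsD1 u (nbr x)) inE xu -(cnbr_adj _ _ xu).
rewrite -(cardsID (nbr u) (nbr x :\ u)) [in LHS]addn1 add1n; congr S.
rewrite addnC; congr addn; apply: eq_card => w; rewrite !inE.
  by case: (altP (w =P u)) => [->|]; rewrite ?eirr ?andbF.
by case: (e x w); case: (w == u); case: (e u w).
Qed.

(** Non-adjacent [a] and [b] would form a claw at [x] together with [u]. *)
Lemma far_adj x u a b : e x u -> a \in far x u -> b \in far x u -> a != b -> e a b.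
Proof.
rewrite !inE => xu /and3P[xa au ua] /and3P[xb bu ub] ab.
by have := no_claw x u a b xu xa xb; rewrite eq_sym au ua bu eq_sym ab (negPf ub); apply.
Qed.

(** Here [a] is adjacent to [v] and [b] to [u]. An edge [a b] would make [v] and [b] common
    neighbours of the non-adjacent [u] and [a], hence adjacent. *)
Lemma far_nadj x u v a b : e u v ->
  a \in far x u -> a \notin far x v -> b \in far x v -> b \notin far x u -> ~~ e a b.
Proof.
rewrite !inE => uv /and3P[xa au ua] + /and3P[xb bv vb]; rewrite xa xb /= !negb_and !negbK.
case: eqP => [av|av /= va]; first by rewrite av uv in ua.
case: eqP => [bu|bu /= ub]; first by rewrite bu esym uv in vb.
apply/negP => ab; have := no_induced_C4 u a v b; rewrite eq_sym au ua uv esym va ub ab.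
by rewrite eq_sym bv (negPf vb); move=> /(_ isT isT isT isT isT isT isT).
Qed.

(* Otherwise u and v would have l common neighbours in x |: nbr x, and z besides. *)
Lemma far_neq x z u v : x != z -> ~~ e x z -> u != v -> e x u -> e z u -> e x v -> e z v ->
  far x u != far x v.
Proof.
move=> xz nxz uv xu zu xv zv.
have euv : e u v by apply: (no_induced_C4 x z).
apply/eqP => fE.
have sub : x |: (z |: (nbr x :\: (u |: (v |: far x u)))) \subset cnbr u v.
  apply/subsetP => w; rewrite in_setU1 => /predU1P[->|]; first by rewrite inE ![e _ x]esym xu xv.
  rewrite in_setU1 => /predU1P[->|]; first by rewrite inE ![e _ z]esym zu zv.
  rewrite in_setD in_setU1 in_setU1 !negb_or => /andP[/and3P[wu wv nf]].
  have := nf; rewrite fE !inE => + xw; rewrite xw wv /= negbK => ->.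
  by move: nf; rewrite !inE xw wu /= negbK => ->.
have := subset_leq_card sub; rewrite cnbr_adj // cardsU1 cardsU1.
rewrite !inE eirr (negPf xz) (negPf nxz) !andbF /= !add1n.
rewrite cardsDS; last first.
  by apply/subsetP => w; rewrite !inE => /predU1P[->//|/predU1P[->//|/and3P[]]].
have vf : v \notin far x u by rewrite fE inE eqxx !andbF.
rewrite cardsU1 cardsU1 vf in_setU1 (negPf uv) !inE eqxx !andbF /= degk.
by have := card_far _ _ xu => h1 h2; clear -h1 h2; lia.
Qed.

(** Otherwise an element of [far x w] missed by [far x u] and one missed by [far x v] would be
    adjacent by [far_adj] and non-adjacent by [far_nadj]. *)
Lemma private_far x u v w : e x u -> e x v -> e x w -> e u v -> e u w -> e v w ->
  far x u != far x w -> far x v != far x w ->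
  exists2 a, a \in far x w & (a \notin far x u) && (a \notin far x v).
Proof.
move=> xu xv xw uv uw vw uNw vNw.
have missing t : e x t -> far x t != far x w -> exists2 b, b \in far x w & b \notin far x t.
  move=> xt tNw; apply/subsetPn; apply: contra tNw => sub.
  rewrite eq_sym eqEcard sub; have := card_far _ _ xt; have := card_far _ _ xw.
  by move=> h1 h2; clear -h1 h2; lia.
have [a aw au] := missing u xu uNw; have [b bw bv] := missing v xv vNw.
have [av|av] := boolP (a \in far x v); last by exists a; rewrite ?au.
have [bu|bu] := boolP (b \in far x u); last by exists b; rewrite ?bu.
have ab : a != b by apply: contraTneq av => ->.
have := far_adj _ _ _ _ xw aw bw ab.
by have := far_nadj x v u a b; rewrite esym uv av au bu bv => /(_ isT isT isT isT isT)/negP.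
Qed.

(** Three common neighbours of [x] and [z] are pairwise adjacent with distinct far sets; a private
    element of each far set gives a claw at [x]. *)
Lemma srg_m_le2 : (exists x y : T, x != y /\ ~~ e x y) -> (m <= 2)%N.
Proof.
move=> [x [z [xz nxz]]]; rewrite leqNgt; apply/negP => m3.
have /card_gt2P[u [v [w [[]]]]] : (2 < #|cnbr x z|)%N by rewrite cnbr_nadj.
rewrite !inE => /andP[xu zu] /andP[xv zv] /andP[xw zw] [uv vw wu].
have adj p q : e x p -> e z p -> e x q -> e z q -> p != q -> e p q.
  by move=> *; apply: (no_induced_C4 x z).
have neq p q : e x p -> e z p -> e x q -> e z q -> p != q -> far x p != far x q.
  by move=> *; apply: (far_neq x z).
have euv := adj _ _ xu zu xv zv uv; have fuv := neq _ _ xu zu xv zv uv.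
have evw := adj _ _ xv zv xw zw vw; have fvw := neq _ _ xv zv xw zw vw.
have ewu := adj _ _ xw zw xu zu wu; have fwu := neq _ _ xw zw xu zu wu.
have [a aw /andP[au av]] : exists2 a, a \in far x w & (a \notin far x u) && (a \notin far x v).
  by apply: private_far => //; rewrite 1?esym 1?eq_sym.
have [b bv /andP[bu bw]] : exists2 a, a \in far x v & (a \notin far x u) && (a \notin far x w).
  by apply: private_far => //; rewrite 1?esym 1?eq_sym.
have [c cu /andP[cv cw]] : exists2 a, a \in far x u & (a \notin far x v) && (a \notin far x w).
  by apply: private_far => //; rewrite 1?esym 1?eq_sym.
have nab : ~~ e a b by apply: (far_nadj x w v); rewrite // esym.
have nac : ~~ e a c by apply: (far_nadj x w u).
have nbc : ~~ e b c by apply: (far_nadj x v u); rewrite // esym.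
have := no_claw x a b c; move: (aw) (bv) (cu); rewrite !inE => /and3P[-> _ _] /and3P[-> _ _] /and3P[-> _ _].
rewrite nab (negPf nac) (negPf nbc); move=> /(_ isT isT isT).
have -> : a != b by apply: contraNneq bw => <-.
have -> : c != a by apply: contraNneq cw => ->.
have -> : c != b by apply: contraNneq cv => ->.
by move=> /(_ isT isT isT isT).
Qed.

(* far x b' would lie in s |: (far x y :\ b1 :\ b2), which is too small: all the sets
   far x _ have the same size. *)
Lemma far_cross y y' x s b1 b2 b' : m = 2%N -> e x y -> e x s ->
  y' \in far x y -> e y s -> e y' s ->
  b1 \in far x s -> b1 \in far x y -> b2 \in far x s -> b2 \in far x y -> b1 != b2 ->
  b' \in far x s -> b' \in far x y' -> False.
Proof.
move=> m2 xy xs y'y ys y's b1s b1y b2s b2y b12 b's b'y'.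
have := y'y; rewrite inE => /and3P[xy' y'Ny yy'].
(* Without claws at [x], the sets [far x y] and [far x y'] are disjoint; the clique [far x s] then
   joins [b] to [b']. *)
have ncross b : b \in far x s -> b \in far x y -> b != b' /\ e b b'.
  move=> bs by_; have b'b : b != b'.
    apply: contraTneq b'y' => <-; move: bs by_.
    rewrite !inE => /and3P[xb bs sb] /and3P[_ bNy yb]; rewrite xb /= negb_and !negbK.
    have := no_claw x y y' b xy xy' xb; rewrite eq_sym y'Ny yy' bNy (negPf yb) /= => H.
    by case: eqVneq => //= by'; rewrite H.
  by split=> //; apply: (far_adj x s).
have [b1b' eb1] := ncross _ b1s b1y; have [b2b' eb2] := ncross _ b2s b2y.
have sub : far x b' \subset s |: (far x y :\ b1 :\ b2).
  apply/subsetP => w; have := b'y'; have := b's; rewrite !inE => /and3P[xb' b'Ns sb'] /and3P[_ b'Ny' y'b'].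
  move=> /and3P[xw wb' b'w]; case: eqVneq => //= ws; rewrite xw /=.
  have -> : w != b2 by apply: contraNneq b'w => ->; rewrite esym.
  have -> /= : w != b1 by apply: contraNneq b'w => ->; rewrite esym.
  have wy : w != y.
    apply: contraNneq b'w => ->; have := no_claw x y y' b' xy xy' xb'.
    rewrite eq_sym y'Ny yy' b'Ny' (negPf y'b') orbF esym; apply => //.
    by apply: contraNneq sb' => ->; rewrite esym.
  rewrite wy /=; apply/negP => yw.
  (* As m = 2, the only common neighbours of [y] and [y'] are [x] and [s]. *)
  have y'w : ~~ e y' w.
    apply/negP => y'w.
    have : [set x; s; w] \subset cnbr y y'.
      by apply/subsetP => t; rewrite !inE => /orP[/orP[]|] /eqP->; rewrite ?ys ?y's ?yw // ![e _ x]esym xy.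
    move/subset_leq_card; rewrite cnbr_nadj ?m2 1?eq_sym //.
    by rewrite setUC cardsU1 cards2 !inE eq_sym negb_or (adj_neq _ _ xw) ws adj_neq.
  have wy' : w != y' by apply: contraNneq yy' => <-.
  by have := far_adj x y' b' w xy' b'y'; rewrite inE xw wy' y'w eq_sym wb' (negPf b'w) => /(_ isT isT).
have := subset_leq_card sub.
have := b's; rewrite inE => /and3P[xb' _ _].
have := card_far x b' xb'; have := card_far x y xy.
rewrite (cardsD1 b1 (far x y)) b1y (cardsD1 b2 (far x y :\ b1)) in_setD1 b2y eq_sym b12 /=.
have := (leq_card_setU [set s] (far x y :\ b1 :\ b2)).1; rewrite cards1 => h1 h2 h3 h4.
by clear -h1 h2 h3 h4; lia.
Qed.

(** With [x] and [s] the two common neighbours of [y] and [y'], all far sets have l elements. The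
    set [far x s] is covered by its intersections with [far x y] and [far x y'], which miss [y'] and
    [y] respectively and so have size at most l - 1. For l >= 3 both are nonempty and one has two
    elements, against [far_cross]. *)
Lemma m2_l_bounds : (exists x y : T, x != y /\ ~~ e x y) -> m = 2%N -> (0 < l <= 2)%N.
Proof.
move=> ex m2; have m0 : (0 < m)%N by rewrite m2.
have kE := srg_parameters ex m0.
have [y [y' [yy' nyy']]] := ex; have [x yx y'x] := common_neighbour m0 _ _ yy' nyy'.
have xy : e x y by rewrite esym.
have xy' : e x y' by rewrite esym.
have xc : x \in cnbr y y' by rewrite inE yx.
have /card_gt0P[s] : (0 < #|cnbr y y' :\ x|)%N.
  by have := cardsD1 x (cnbr y y'); rewrite xc cnbr_nadj // m2 add1n => -[<-].
rewrite !inE => /and3P[sx ys y's].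
have xs : e x s by apply: (no_induced_C4 y y'); rewrite // eq_sym.
have y'y : y' \in far x y by rewrite inE xy' eq_sym yy' nyy'.
have yy'f : y \in far x y' by rewrite inE xy yy' esym nyy'.
have sub : far x s \subset (far x s :&: far x y) :|: (far x s :&: far x y').
  rewrite -setIUr subsetI subxx /=; apply/subsetP => w; rewrite !inE => /and3P[xw ws sw].
  rewrite xw /= -negb_or -negb_or -negb_and; apply/negP => /andP[wy wy'].
  have yw : e y w by case/orP: wy => // /eqP E; rewrite E esym ys in sw.
  have y'w : e y' w by case/orP: wy' => // /eqP E; rewrite E esym y's in sw.
  have : [set x; s; w] \subset cnbr y y'.
    by apply/subsetP => t; rewrite !inE => /orP[/orP[]|] /eqP->; rewrite ?ys ?y's ?yw ?yx.
  move/subset_leq_card; rewrite cnbr_nadj ?m2 //.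
  by rewrite setUC cardsU1 cards2 !inE eq_sym negb_or (adj_neq _ _ xw) ws adj_neq.
have side u u' : u' \in far x u -> e u' s -> far x s :&: far x u \subset far x u :\ u'.
  move=> u'u u's; apply/subsetP => w; rewrite !inE => /andP[/and3P[-> ws sw] /and3P[_ -> ->]].
  by rewrite /= andbT; apply: contraNneq sw => ->; rewrite esym.
have := subset_leq_card (side _ _ y'y y's); have := subset_leq_card (side _ _ yy'f ys).
have := cardsD1 y' (far x y); have := cardsD1 y (far x y'); rewrite y'y yy'f.
have := subset_leq_card sub; have := (leq_card_setU (far x s :&: far x y) (far x s :&: far x y')).1.
have := card_far _ _ xy; have := card_far _ _ xy'; have := card_far _ _ xs => c1 c2 c3 c4 c5 c6 c7 c8 c9.
apply/andP; split; first by clear -c3 c6 c7 m2 kE; lia.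
rewrite leqNgt; apply/negP => l3.
have /card_gt0P[b] : (0 < #|far x s :&: far x y|)%N by clear -c1 c2 c3 c4 c5 c6 c7 c8 c9 kE m2; lia.
have /card_gt0P[b'] : (0 < #|far x s :&: far x y'|)%N by clear -c1 c2 c3 c4 c5 c6 c7 c8 c9 kE m2; lia.
rewrite !in_setI => /andP[b's b'y'] /andP[bs by_].
have [/card_gt1P[c [c' []]]|small] := ltnP 1 #|far x s :&: far x y|.
  rewrite !in_setI => /andP[? ?] /andP[? ?] cc'.
  exact: (far_cross y y' x s c c' b').
have /card_gt1P[c [c' []]] : (1 < #|far x s :&: far x y'|)%N by clear -c1 c4 c5 l3 kE m2 small; lia.
rewrite !in_setI => /andP[? ?] /andP[? ?] cc'.
exact: (far_cross y' y x s c c' b).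
Qed.

End LargeLambda.

Lemma srg_m_neq2 : (exists x y : T, x != y /\ ~~ e x y) -> (k + m <= l.*2 + 3)%N ->
  m <> 2%N.
Proof.
move=> ex small m2; have m0 : (0 < m)%N by rewrite m2.
have kE := srg_parameters small ex m0; have lb := m2_l_bounds small ex m2.
case: ex => x _; have := srg_count x; have := handshake.
have -> : k = (l.*2 + 1)%N by lia.
(* For l = 1 the count reads 2 n = 11; for l = 2 it gives n = 11 with k = 5, an odd product. *)
rewrite m2; case: (l) lb => [|[|[|]]] //= _ par cnt; first by lia.
have nE : n = 11%N by lia.
by rewrite nE in par.
Qed.

(** Private neighbours [x'], [y'], [z'] of the triangle are pairwise non-adjacent. Their pairwise
    common neighbours [p], [q], [r] form a triangle, so [x'] and [q] share both [p] and [r] and must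
    be adjacent; then [q] is the centre of a claw. *)
Lemma m1_no_triangle x y z : (k = l.*2 + 2)%N -> m = 1%N -> e x y -> e x z -> e y z -> False.
Proof.
move=> kE m1 xy xz yz.
have small : (k + m <= l.*2 + 3)%N by lia.
have exit p q : e p q -> exists2 p', e p p' & (p' != q) && ~~ e q p'.
  move=> pq; have /card_gt0P[p'] : (0 < #|[set w | [&& e p w, w != q & ~~ e q w]]|)%N.
    by have := card_far _ _ pq; lia.
  by rewrite inE => /and3P[pp' p'q qp']; exists p'; rewrite ?p'q.
have uniq p q u v := unique_common_neighbour p q u v m1.
have third p q t p' : e p q -> e p t -> e q t -> e p p' -> p' != q -> ~~ e q p' -> (p' != t) && ~~ e t p'.
  move=> pq pt qt pp' p'q qp'; have -> /= : p' != t by apply: contraNneq qp' => ->.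
  apply/negP => tp'; have := uniq p' q p t; rewrite p'q esym qp' esym pp' esym pq ![e _ t]esym tp' [e t q]esym qt.
  by move/(_ isT isT isT isT isT isT)=> ptE; rewrite ptE eirr in pt.
have yx : e y x by rewrite esym.
have zx : e z x by rewrite esym.
have zy : e z y by rewrite esym.
have [x' xx' /andP[x'y yx']] := exit x y xy.
have /andP[x'z zx'] := third _ _ _ _ xy xz yz xx' x'y yx'.
have [y' yy' /andP[y'z zy']] := exit y z yz.
have /andP[y'x xy'] := third _ _ _ _ yz yx zx yy' y'z zy'.
have [z' zz' /andP[z'x xz']] := exit z x zx.
have /andP[z'y yz'] := third _ _ _ _ zx zy xy zz' z'x xz'.
have apart p q p' q' : e p q -> e p p' -> e q q' -> p' != q -> ~~ e q p' -> q' != p -> ~~ e p q' ->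
    (p' != q') && ~~ e p' q'.
  move=> pq pp' qq' p'q qp' q'p pq'; have -> /= : p' != q' by apply: contraNneq qp' => ->.
  (* An edge [p' q'] would make [p] and [q'] two common neighbours of [p'] and [q]. *)
  apply/negP => pq1; have := uniq p' q p q'; rewrite p'q esym qp' esym pp' esym pq pq1 qq'.
  by move/(_ isT isT isT isT isT isT)/eqP; rewrite eq_sym (negPf q'p).
have /andP[x'y' nx'y'] := apart _ _ _ _ xy xx' yy' x'y yx' y'x xy'.
have /andP[y'z' ny'z'] := apart _ _ _ _ yz yy' zz' y'z zy' z'y yz'.
have /andP[z'x' nz'x'] := apart _ _ _ _ zx zz' xx' z'x xz' x'z zx'.
have m0 : (0 < m)%N by rewrite m1.
have [p x'p y'p] := common_neighbour m0 _ _ x'y' nx'y'.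
have [q y'q z'q] := common_neighbour m0 _ _ y'z' ny'z'.
have [r z'r x'r] := common_neighbour m0 _ _ z'x' nz'x'.
have not3 t : e x' t -> e y' t -> e z' t -> False.
  move=> xt yt zt; have := no_claw small t x' y' z'; rewrite ![e t _]esym xt yt zt x'y' nx'y' z'x'.
  by rewrite eq_sym y'z' [e x' _]esym (negPf nz'x') (negPf ny'z') => /(_ isT isT isT isT isT isT isT).
have pq : p != q by apply/eqP => E; apply: (not3 p) => //; rewrite E.
have qr : q != r by apply/eqP => E; apply: (not3 q) => //; rewrite E.
have rp : r != p by apply/eqP => E; apply: (not3 r) => //; rewrite E.
(* a is a neighbour of a' adjacent to neither u nor v, so having no claw at a' forces e u v *)
have far_edge a a' b b' c c' u v : e a a' -> e a b -> e a c -> e b b' -> e c c' ->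
    ~~ e b a' -> ~~ e c a' ->
    b' != a -> ~~ e a b' -> c' != a -> ~~ e a c' -> e a' u -> e b' u -> e a' v -> e c' v ->
    u != v -> e u v.
  move=> aa' ab ac bb' cc' ba' ca' b'a ab' c'a ac' a'u b'u a'v c'v uv.
  have nau : ~~ e a u.
    apply/negP => au; have := uniq a b' b u; rewrite eq_sym b'a ab' ab esym bb' au b'u.
    by move/(_ isT isT isT isT isT isT)=> buE; rewrite buE esym a'u in ba'.
  have nav : ~~ e a v.
    apply/negP => av; have := uniq a c' c v; rewrite eq_sym c'a ac' ac esym cc' av c'v.
    by move/(_ isT isT isT isT isT isT)=> cvE; rewrite cvE esym a'v in ca'.
  have au : a != u by apply: contraNneq ab' => ->; rewrite esym.
  have av : a != v by apply: contraNneq ac' => ->; rewrite esym.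
  have := no_claw small a' a u v; rewrite esym aa' a'u a'v au nau eq_sym av eq_sym uv (negPf nav) /=.
  exact.
have epr : e p r.
  by apply: (far_edge x x' y y' z z') => //; rewrite eq_sym.
have epq : e p q.
  by apply: (far_edge y y' x x' z z').
have erq : e r q.
  by apply: (far_edge z z' x x' y y') => //; rewrite eq_sym.
apply: (not3 q) => //; apply: contraTT (epr) => nx'q.
have x'q : x' != q by apply: contraNneq nx'y' => ->; rewrite esym.
have := uniq x' q p r; rewrite x'q nx'q x'p x'r [e q p]esym epq [e q r]esym erq.
by move/(_ isT isT isT isT isT isT) => ->; rewrite eirr.
Qed.

End StronglyRegular.

(** * The pentagon *)

Section Pentagon.
Variables (T : finType) (e : rel T) (n : nat).
Hypotheses (esym : symmetric e) (eirr : irreflexive e).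
Hypothesis Hsrg : srg e n 2 0 1.

Lemma srg_pentagon : (exists x y : T, x != y /\ ~~ e x y) -> isC5 e.
Proof.
move=> [a [b [ab nab]]].
have [x ax bx] := common_neighbour _ _ _ _ _ _ Hsrg isT _ _ ab nab.
have second p q : e p q -> exists2 r, r != q & forall w, e p w = (w == q) || (w == r).
  case: Hsrg => _ /(_ p)/eqP/cards2P[u [v [uv pE]]] _ _.
  have eE w : e p w = (w == u) || (w == v) by rewrite -in_set2 -pE inE.
  rewrite eE => /orP[] /eqP->; first by exists v; rewrite // eq_sym.
  by exists u => // w; rewrite orbC.
have [a' a'x eaE] := second _ _ ax; have [b' b'x ebE] := second _ _ bx.
have [b1 _ exE] : exists2 r, r != a & forall w, e x w = (w == a) || (w == r).
  by apply: second; rewrite esym.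
have {exE} exE w : e x w = (w == a) || (w == b).
  by have := exE b; rewrite esym bx eq_sym (negPf ab) /= => H; rewrite (eqP (Logic.eq_sym H)).
have aa' : e a a' by rewrite eaE eqxx orbT.
have bb' : e b b' by rewrite ebE eqxx orbT.
have a'b' : a' != b'.
  apply: contraNneq a'x => E; apply/eqP.
  by apply: (unique_common_neighbour _ _ _ _ _ _ Hsrg a b); rewrite // E.
have a'b : a' != b by apply: contraNneq nab => <-.
have b'a : b' != a by apply: contraNneq nab => <-; rewrite esym.
have a'a : a' != a by rewrite eq_sym (adj_neq _ _ eirr).
have b'b : b' != b by rewrite eq_sym (adj_neq _ _ eirr).
have nba' : ~~ e b a' by rewrite ebE negb_or a'x.
have nab' : ~~ e a b' by rewrite eaE negb_or b'x eq_sym.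
have ea'b' : e a' b'.
  have [|z a'z] := common_neighbour _ _ _ _ _ _ Hsrg isT _ _ a'b; first by rewrite esym.
  rewrite ebE => /orP[] /eqP zE; last by rewrite -zE.
  by move: a'z; rewrite zE esym exE (negPf a'a) (negPf a'b).
have ea'E w : e a' w = (w == a) || (w == b').
  have [|c _ cE] := second a' a; first by rewrite esym.
  by have := cE b'; rewrite ea'b' (negPf b'a) /= => H; rewrite (eqP (Logic.eq_sym H)).
have eb'E w : e b' w = (w == b) || (w == a').
  have [|c _ cE] := second b' b; first by rewrite esym.
  by have := cE a'; rewrite esym ea'b' (negPf a'b) /= => H; rewrite (eqP (Logic.eq_sym H)).
have xa : x != a by rewrite eq_sym (adj_neq _ _ eirr).
have xb : x != b by rewrite eq_sym (adj_neq _ _ eirr).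
(* The pentagon in cyclic order. *)
pose s := [:: x; a; a'; b'; b].
have us : uniq s.
  by rewrite /= !inE !negb_or xa xb ![x == _]eq_sym a'x b'x ![a == _]eq_sym a'a b'a ![b == _]eq_sym ab a'b' a'b b'b.
(* A vertex not adjacent to [x] shares a neighbour with it, which is [a] or [b], so it is [a'] or
   [b']. *)
have ins w : w \in s.
  rewrite !inE; case: (eqVneq w x) => //= wx.
  case exw: (e x w).
    by move: exw; rewrite exE => /orP[] /eqP->; rewrite eqxx ?orbT.
  rewrite eq_sym in wx; move/negbT: exw => nxw.
  have [z] := common_neighbour _ _ _ _ _ _ Hsrg isT _ _ wx nxw.
  rewrite exE => /orP[] /eqP->; rewrite esym ?eaE ?ebE (negPf (_ : w != x)) 1?eq_sym //= => ->;
    by rewrite ?orbT.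
have sz w : (index w s < 5)%N by rewrite -[5%N]/(size s) index_mem.
exists (fun w => Ordinal (sz w)); split.
  exists (fun i : 'I_5 => nth x s i) => [w|i]; first by rewrite /= nth_index.
  by apply: val_inj; apply: index_uniq => //; case: i.
move=> w w'; rewrite -{1}(nth_index x (ins w)).
(* Adding 4 modulo 5 gives the predecessor on the cycle. *)
have -> : e (nth x s (index w s)) w' =
    (w' == nth x s ((index w s).+1 %% 5)) || (w' == nth x s ((index w s + 4) %% 5)).
  case: (index w s) (sz w) => [|[|[|[|[|i]]]]] //= _; rewrite ?exE ?eaE ?ea'E ?eb'E ?ebE //; exact: orbC.
have key (i j : 'I_5) :
    (nth x s j == nth x s (i.+1 %% 5)) || (nth x s j == nth x s ((i + 4) %% 5)) = c5adj i j.
  rewrite /c5adj !nth_uniq ?ltn_pmod ?ltn_ord //.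
  by case: i j => [[|[|[|[|[|i]]]]] ?] [[|[|[|[|[|j]]]]] ?].
by have := key (Ordinal (sz w)) (Ordinal (sz w')); rewrite [nth x s (Ordinal (sz w'))]nth_index.
Qed.

End Pentagon.

(** * Reduction to the pentagon *)

Lemma srg_large_lambda_pentagon (T : finType) (e : rel T) (n k l m : nat) :
  symmetric e -> irreflexive e -> srg e n k l m -> (0 < m)%N ->
  (exists x y : T, x != y /\ ~~ e x y) -> (k + m <= l.*2 + 3)%N -> isC5 e.
Proof.
move=> esym eirr Hsrg m0 ex small.
have kE := srg_parameters _ _ _ _ _ _ esym eirr Hsrg small ex m0.
have m1 : m = 1%N.
  have := srg_m_le2 _ _ _ _ _ _ esym eirr Hsrg small ex; have := srg_m_neq2 _ _ _ _ _ _ esym eirr Hsrg ex small; lia.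
have l0 : l = 0%N.
  apply/eqP; rewrite -leqn0 leqNgt; apply/negP => l0.
  have [a [b [ab nab]]] := ex.
  have [x ax _] := common_neighbour _ _ _ _ _ _ Hsrg m0 _ _ ab nab.
  case: (Hsrg) => _ _ /(_ _ _ ax) lE _.
  move: l0; rewrite -lE => /card_gt0P[z]; rewrite inE => /andP[az xz].
  by apply: (m1_no_triangle _ _ _ _ _ _ esym eirr Hsrg a x z) => //; lia.
have k2 : k = 2%N by lia.
by rewrite k2 l0 m1 in Hsrg; apply: (srg_pentagon _ _ n).
Qed.

(** * The smaller restricted eigenvalue *)

Section Spectral.
Variables (T : finType) (e : rel T) (n k l m : nat).
Hypotheses (esym : symmetric e) (eirr : irreflexive e).
Hypothesis Hsrg : srg e n k l m.
Hypothesis m_gt0 : (0 < m)%N.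
Hypothesis ex_nadj : exists x y : T, x != y /\ ~~ e x y.

(* On functions, the distance matrix is 2 J - 2 I - A. *)
Lemma distQE (R : numDomainType) (f : T -> R) :
  distQ e f = 2 * (\sum_x f x) ^+ 2 - 2 * (\sum_x f x ^+ 2)
              - \sum_x f x * (\sum_(y | e x y) f y).
Proof.
rewrite expr2 mulr_suml !mulr_sumr -!sumrB; apply: eq_bigr => x _.
rewrite (bigD1 x) //= (bigID (e x)) /= (srg_gdist _ _ _ _ _ _ esym eirr Hsrg) // eqxx.
rewrite (sum_adj_split _ _ eirr _ f x).
rewrite (eq_bigl (e x)); last by move=> z; rewrite andb_idl // => /(adj_neq _ _ eirr); rewrite eq_sym.
rewrite (eq_bigr (fun y => f x * f y)); last first.
  move=> y xy; rewrite (srg_gdist _ _ _ _ _ _ esym eirr Hsrg) // xy.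
  by rewrite (negPf (adj_neq _ _ eirr _ _ xy)) mulr1.
rewrite -mulr_sumr [X in _ + (_ + X) = _](eq_bigr (fun y => f x * 2 * f y)); last first.
  move=> y /andP[yx xy]; rewrite (srg_gdist _ _ _ _ _ _ esym eirr Hsrg) //.
  by rewrite eq_sym (negPf yx) (negPf xy).
rewrite -mulr_sumr; ring.
Qed.

(* Applying A - r to a function of sum 0, where r >= 0 is the larger of the two
   restricted eigenvalues, leaves an eigenvector for the smaller one. *)
Lemma small_eigenvector (R : rcfType) : (l.*2 + 4 <= k + m)%N ->
  exists (h : T -> R) (s : R), [/\ s <= -2, exists x, h x != 0, \sum_x h x = 0 &
    forall x, \sum_(y | e x y) h y = s * h x].
Proof.
move=> big.
have [a [b [ab nab]]] := ex_nadj.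
have [y ay by_] := common_neighbour _ _ _ _ _ _ Hsrg m_gt0 _ _ ab nab.
have mk : (m <= k)%N.
  case: Hsrg => _ /(_ a) <- _ /(_ a b ab nab) <-.
  by apply/subset_leq_card/fintype.subsetP => z; rewrite !inE => /andP[].
pose L : R := l%:R - m%:R; pose K : R := k%:R - m%:R.
have K0 : 0 <= K by rewrite subr_ge0 ler_nat.
have big' : 2 * L + 4 <= K.
  have : (l.*2 + 4)%:R <= (k + m)%:R :> R by rewrite ler_nat.
  by rewrite /L /K !natrD -muln2 natrM; lra.
pose D := Num.sqrt (L ^+ 2 + 4 * K).
have D0 : 0 <= D by apply: sqrtr_ge0.
have DE : D ^+ 2 = L ^+ 2 + 4 * K by rewrite sqr_sqrtr // addr_ge0 ?sqr_ge0 // mulr_ge0.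
pose r := (L + D) / 2; pose s := (L - D) / 2.
have r0 : 0 <= r by rewrite /r; nra.
(* This amounts to L + 4 <= D, where D^2 - (L + 4)^2 = 4 (K - 2 L - 4). *)
have s2 : s <= -2 by rewrite /s; nra.
have rsD : r + s = L by rewrite /r /s; field.
have rsM : r * s = - K.
  by rewrite /r /s; transitivity ((L ^+ 2 - D ^+ 2) / 4); [field | rewrite DE; field].
(* Since [a] and [y] are adjacent, (A - r) g takes the nonzero value - 1 - r at [a]. *)
pose g x : R := (x == a)%:R - (x == y)%:R.
have gsum : \sum_x g x = 0.
  have delta c : \sum_x (x == c)%:R = 1 :> R.
    by rewrite (bigD1 c) //= eqxx big1 ?addr0 // => i /negPf->.
  by rewrite sumrB !delta subrr.
pose Ag x := \sum_(z | e x z) g z.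
have AAg x : \sum_(z | e x z) Ag z = L * Ag x + K * g x.
  rewrite (sum_walks2 _ _ _ _ _ _ esym eirr Hsrg) -/(Ag x).
  move: gsum; rewrite (sum_adj_split _ _ eirr _ _ x) -/(Ag x).
  move/eqP; rewrite addrC addr_eq0 => /eqP->; rewrite /L /K; ring.
exists (fun x => Ag x - r * g x), s; split=> //.
- exists a; rewrite /Ag sumrB.
  have -> : \sum_(z | e a z) (z == a)%:R = 0 :> R.
    by apply: big1 => z az; rewrite eq_sym (negPf (adj_neq _ _ eirr _ _ az)).
  rewrite (bigD1 y) //= eqxx big1; last by move=> z /andP[_ /negPf->].
  rewrite /g eqxx (negPf (adj_neq _ _ eirr _ _ ay)) subr0 mulr1 addr0 sub0r lt_eqF // mulr1n; lra.
- rewrite sumrB -mulr_sumr gsum mulr0 subr0 (exchange_big_dep predT) //=.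
  rewrite (eq_bigr (fun z => k%:R * g z)) => [|z _]; first by rewrite -mulr_sumr gsum mulr0.
  rewrite sumr_const [RHS]mulr_natl; congr (_ *+ _); case: Hsrg => _ /(_ z) <- _ _.
  by apply: eq_card => x; rewrite inE esym.
- move=> x; rewrite sumrB AAg -mulr_sumr -/(Ag x).
  transitivity ((L - r) * Ag x + K * g x); first by ring.
  rewrite -rsD; have -> : K = - (r * s) by rewrite rsM opprK.
  ring.
Qed.

(** On the normalised eigenvector for [s] the distance form equals - 2 - s. *)
Lemma srg_distQ_ge0 (R : rcfType) : (l.*2 + 4 <= k + m)%N ->
  exists f : T -> R, [/\ \sum_x f x ^+ 2 = 1, \sum_x f x = 0 & 0 <= distQ e f].
Proof.
move=> big; have [h [s [s2 [x hx0] hsum hA]]] := small_eigenvector R big.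
pose N := \sum_x h x ^+ 2.
have N0 : 0 < N.
  rewrite /N (bigD1 x) //= ltr_pwDl ?sumr_ge0 // => [|*]; last exact: sqr_ge0.
  by rewrite lt_def sqr_ge0 sqrf_eq0 hx0.
pose c := (Num.sqrt N)^-1.
have cN : c ^+ 2 * N = 1.
  by rewrite /c exprVn sqr_sqrtr ?ltW // mulVf // gt_eqF.
have sq : \sum_x (c * h x) ^+ 2 = 1.
  by under eq_bigr do rewrite exprMn; rewrite -mulr_sumr.
have s0 : \sum_x (c * h x) = 0 by rewrite -mulr_sumr hsum mulr0.
exists (fun x => c * h x); split=> //.
rewrite distQE sq s0.
rewrite (eq_bigr (fun x => s * (c ^+ 2 * h x ^+ 2))); last first.
  by move=> z _; rewrite -mulr_sumr hA; ring.
by rewrite -!mulr_sumr cN; lra.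
Qed.

End Spectral.

(** * The quadratic embedding constant of the pentagon *)

Lemma c5_form_le (R : rcfType) (a b c d f : R) (s := Num.sqrt 5 : R) :
  a + b + c + d + f = 0 -> a ^+ 2 + b ^+ 2 + c ^+ 2 + d ^+ 2 + f ^+ 2 = 1 ->
  - 2 - 2 * (a * b + b * c + c * d + d * f + f * a) <= - ((3 - s) / 2).
Proof.
move=> sum0 sq1.
have ss : s ^+ 2 = 5 by rewrite sqr_sqrtr.
have s0 : 0 < s by rewrite sqrtr_gt0.
(* The least eigenvalue of the pentagon is [- phi], and phi - 2 = - (3 - s) / 2. *)
pose phi := (1 + s) / 2.
pose N := a ^+ 2 + b ^+ 2 + c ^+ 2 + d ^+ 2 + f ^+ 2.
pose P := a * b + b * c + c * d + d * f + f * a.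
(* phi + A has eigenvalues 0 and s on sum-zero functions, so its square is s times itself. *)
have key : s * (phi * N + 2 * P) =
   (phi * a + b + f) ^+ 2 + (phi * b + a + c) ^+ 2 + (phi * c + b + d) ^+ 2
   + (phi * d + c + f) ^+ 2 + (phi * f + d + a) ^+ 2.
  have fE : f = - (a + b + c + d) by apply/eqP; rewrite -addr_eq0 addrC sum0.
  (* The vanishing last term makes this an identity in a free [s]. *)
  transitivity ((phi * a + b + f) ^+ 2 + (phi * b + a + c) ^+ 2 + (phi * c + b + d) ^+ 2
   + (phi * d + c + f) ^+ 2 + (phi * f + d + a) ^+ 2 + (s ^+ 2 - 5) * (N / 4)).
    by rewrite /phi /N /P fE; field.
  by rewrite ss subrr mul0r addr0.
have : 0 <= phi * N + 2 * P.
  by rewrite -(pmulr_rge0 _ s0) key !addr_ge0 ?sqr_ge0.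
by rewrite /N sq1 -/P /phi; lra.
Qed.

From mathcomp Require Import classical_sets reals.

Lemma QEC_C5 (R : realType) (T : finType) (e : rel T) (n k l m : nat) :
  symmetric e -> irreflexive e -> srg e n k l m -> (0 < m)%N ->
  (exists x y : T, x != y /\ ~~ e x y) -> isC5 e ->
  QEC e R = - ((3 - Num.sqrt 5) / 2).
Proof.
move=> esym eirr Hsrg m0 nadj [phi [[psi phiK psiK] eE]].
pose v i (lti : (i < 5)%N) := psi (Ordinal lti).
have sumE (F : T -> R) : \sum_x F x =
    F (v 0%N isT) + F (v 1%N isT) + F (v 2%N isT) + F (v 3%N isT) + F (v 4%N isT).
  rewrite (reindex psi) /=; last by exists phi => i _; rewrite ?phiK ?psiK.
  rewrite !big_ord_recl big_ord0 addr0 !addrA.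
  by congr (F (psi _) + F (psi _) + F (psi _) + F (psi _) + F (psi _)); apply: val_inj.
have eV i j lti ltj : e (v i lti) (v j ltj) = c5adj (Ordinal lti) (Ordinal ltj).
  by rewrite eE !psiK.
have QE (f : T -> R) : \sum_x f x ^+ 2 = 1 -> \sum_x f x = 0 ->
    distQ e f = -2 - 2 * (f (v 0%N isT) * f (v 1%N isT) + f (v 1%N isT) * f (v 2%N isT)
      + f (v 2%N isT) * f (v 3%N isT) + f (v 3%N isT) * f (v 4%N isT) + f (v 4%N isT) * f (v 0%N isT)).
  move=> sq1 sum0; rewrite (distQE _ _ _ _ _ _ esym eirr Hsrg) // sq1 sum0 sumE.
  by rewrite 5!(big_mkcond (e _)) /= !sumE !eV /c5adj /=; ring.
have ub (f : T -> R) : \sum_x f x ^+ 2 = 1 -> \sum_x f x = 0 ->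
    distQ e f <= - ((3 - Num.sqrt 5) / 2).
  by move=> sq1 sum0; rewrite QE //; apply: c5_form_le; [rewrite -(sumE f) | rewrite -(sumE (fun x => f x ^+ 2))].
(* the eigenvector (0, 1, - p, p, -1) of the pentagon for the eigenvalue - p *)
pose s : R := Num.sqrt 5; pose p := (1 + s) / 2.
have ss : s ^+ 2 = 5 by rewrite sqr_sqrtr.
have pp : p ^+ 2 = p + 1.
  by rewrite /p; transitivity ((1 + 2 * s + s ^+ 2) / 4); [field | rewrite ss; field].
have p0 : 0 < 2 * p + 4 by rewrite /p; have : 0 <= s := sqrtr_ge0 _; lra.
(* By [pp], the squared norm 2 p^2 + 2 of the eigenvector is 2 p + 4. *)
pose c := (Num.sqrt (2 * p + 4))^-1.
have c2 : c ^+ 2 * (2 * p + 4) = 1.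
  by rewrite /c exprVn sqr_sqrtr ?ltW // mulVf // gt_eqF.
pose f x := c * [:: 0; 1; - p; p; -1]`_(phi x).
have fV i lti : f (v i lti) = c * [:: 0; 1; - p; p; -1]`_i by rewrite /f psiK.
have fsq : \sum_x f x ^+ 2 = 1.
  rewrite sumE !fV /=; transitivity (c ^+ 2 * (2 * p ^+ 2 + 2)); first by ring.
  by rewrite pp -[RHS]c2; ring.
have fsum : \sum_x f x = 0 by rewrite sumE !fV /=; ring.
have fQ : distQ e f = - ((3 - s) / 2).
  rewrite QE // !fV /=.
  transitivity (- 2 + c ^+ 2 * (2 * p ^+ 2 + 4 * p)); first by ring.
  transitivity (- 2 + p * (c ^+ 2 * (2 * p + 4))); first by ring.
  by rewrite c2 /p; field.
apply/eqP; rewrite eq_le; apply/andP; split.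
  apply: ge_sup; first by exists (distQ e f), f.
  by move=> _ [g [gsq gsum] <-]; apply: ub.
rewrite -[X in X <= _]fQ; apply: ub_le_sup; last by exists f.
by exists (- ((3 - s) / 2)) => _ [g [gsq gsum] <-]; apply: ub.
Qed.

Theorem theorem1p3 (R : realType) (T : finType) (e : rel T)
  (esym : symmetric e) (eirr : irreflexive e)
  (n k l m : nat) (Hsrg : srg e n k l m) (Hmu : (1 <= m)%N)
  (Hnc : exists x y : T, x != y /\ ~~ e x y) :
  (~ isC5 e -> 0 <= QEC e R) /\
  (isC5 e -> QEC e R = - ((3 - Num.sqrt 5) / 2)).
Proof.
split; last exact: (QEC_C5 _ _ _ n k l m).
move=> nC5.
have big : (l.*2 + 4 <= k + m)%N.
  rewrite addnS ltnNge; apply/negP => small; apply: nC5.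
  exact: (srg_large_lambda_pentagon _ _ n k l m).
have [f [fsq fsum fQ]] := srg_distQ_ge0 _ _ _ _ _ _ esym eirr Hsrg Hmu Hnc R big.
rewrite /QEC; set A := (X in sup X).
(* sup is 0 on a set without supremum *)
have [Asup|/sup_out->//] := boolp.EM (has_sup A).
by apply: le_trans fQ _; apply: ub_le_sup; [case: Asup | exists f].
Qed.
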